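(* A non-helical and non-planar Bertrand curve $\gamma$ in Euclidean 3-space (with non-helical and non-planar Bertrand mate $\widetilde\gamma$) is a slant helix if and only if the binormal indicatrix $\gamma_b=B$ of $\gamma$ is a spherical helix.
   Context: Curves are smooth regular curves in $\mathbb{R}^3$ with non-vanishing curvature; $\gamma$ is parameterized by arclength $s$ with Frenet frame $T,N,B$, curvature $\kappa$, torsion $\tau$. $\gamma$ is a Bertrand curve with Bertrand mate $\widetilde\gamma$ if there is a correspondence of points such that the principal normals at corresponding points are linearly dependent, $N=\epsilon\widetilde N$ with $\epsilon=\pm1$, and $\widetilde\gamma(s^{*})=\gamma(s)+\lambda N(s)$ with $\lambda\neq0$ constant. Non-helical means that torsion/curvature is not constant, non-planar that the torsion is non-zero (at each point). A slant helix is a curve whose principal normal lines make a constant angle with a fixed straight line. The binormal indicatrix of $\gamma$ is the curve $s\mapsto B(s)$ on the unit sphere. A spherical helix is a curve on the sphere which is a (general) helix, i.e. the ratio of its torsion to its curvature is constant. *)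

(* Defs.v *)
From HB Require Import structures.
From mathcomp Require Import all_boot all_order all_algebra.
From mathcomp Require Import all_classical all_reals all_analysis.

Set Implicit Arguments.
Unset Strict Implicit.
Unset Printing Implicit Defensive.

Import Order.TTheory GRing.Theory Num.Theory.
Import numFieldNormedType.Exports.

Local Open Scope classical_set_scope.
Local Open Scope ring_scope.

Section EuclideanSpace.
Variable R : realType.
Implicit Types u v : 'rV[R]_3.

Definition dot u v : R := \sum_(i < 3) u 0 i * v 0 i.

(* The library norm on matrices is the sup norm, hence a separate Euclidean
   norm; the two induce the same topology, so the library notions of limit and
   derivative apply unchanged. *)
Definition enorm u : R := Num.sqrt (dot u u).

(* Indices are added in 'I_3, i.e. modulo 3. *)
Definition cross u v : 'rV[R]_3 :=
  \row_(k < 3) (u 0 (k + 1) * v 0 (k + 1 + 1) - u 0 (k + 1 + 1) * v 0 (k + 1)).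

(* The angle in [0, pi/2] between the unoriented lines directed by u and v. *)
Definition line_angle u v : R := acos (`|dot u v| / (enorm u * enorm v)).

End EuclideanSpace.

(* The Frenet apparatus of a regular curve with an arbitrary parameter t:
   dividing by the speed enorm (derive1 c t) turns d/dt into the derivative d/ds
   with respect to arclength, so that dT/ds = kappa N and dB/ds = - tau N.
   The general parameter is needed because B, as a curve in the arclength s
   of c, is not itself parameterized by arclength. *)
Section Frenet.
Variable R : realType.
Implicit Types (I : set R) (c : R -> 'rV[R]_3) (t : R).

Definition tangent_vec c t : 'rV[R]_3 := (enorm (derive1 c t))^-1 *: derive1 c t.

Definition curvature c t : R :=
  enorm (derive1 (tangent_vec c) t) / enorm (derive1 c t).

Definition normal_vec c t : 'rV[R]_3 :=
  (enorm (derive1 (tangent_vec c) t))^-1 *: derive1 (tangent_vec c) t.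

Definition binormal_vec c t : 'rV[R]_3 :=
  cross (tangent_vec c t) (normal_vec c t).

Definition torsion c t : R :=
  - dot (derive1 (binormal_vec c) t) (normal_vec c t) / enorm (derive1 c t).

Definition open_interval I : Prop := [/\ I !=set0, open I & is_interval I].

Definition smooth_on I c : Prop :=
  forall (n : nat) (t : R), I t -> derivable (derive1n n c) t 1.

Definition regular_curve I c : Prop :=
  [/\ open_interval I, smooth_on I c,
      forall t, I t -> derive1 c t != 0 & forall t, I t -> curvature c t != 0].

Definition unit_speed I c : Prop := forall t, I t -> enorm (derive1 c t) = 1.

Definition helix I c : Prop :=
  exists k : R, forall t, I t -> torsion c t / curvature c t = k.

Definition non_planar I c : Prop := forall t, I t -> torsion c t != 0.

Definition slant_helix I c : Prop :=
  exists (d : 'rV[R]_3) (theta : R), d != 0 /\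
    forall t, I t -> line_angle (normal_vec c t) d = theta.

Definition spherical_helix I c : Prop :=
  [/\ regular_curve I c, forall t, I t -> enorm (c t) = 1 & helix I c].

(* The correspondence of points is the bijection phi, s |-> s^*, between the
   parameter intervals. *)
Definition bertrand_mate I c (J : set R) (c' : R -> 'rV[R]_3) : Prop :=
  exists (phi : R -> R) (lambda eps : R),
    [/\ set_bij I J phi, lambda != 0, eps = 1 \/ eps = -1,
        forall s, I s -> normal_vec c s = eps *: normal_vec c' (phi s)
      & forall s, I s -> c' (phi s) = c s + lambda *: normal_vec c s].

End Frenet.

(* Main.v *)
(* By Frenet's equations [B' = - tau |gamma'| N], so the unit tangent of the
   binormal indicatrix is [N] up to a locally constant sign.  By Lancret's
   theorem the indicatrix is a helix iff its unit tangent makes a constant angle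
   with a fixed direction [d], i.e. iff [<N', d> = 0] on [I], which is the
   condition for [gamma] to be a slant helix. *)
Require Import Defs.
From mathcomp Require Import all_boot all_order all_algebra.
From mathcomp Require Import all_classical all_reals all_analysis.
From mathcomp Require Import ring.

Set Implicit Arguments.
Unset Strict Implicit.
Unset Printing Implicit Defensive.

Import Order.TTheory GRing.Theory Num.Theory.
Import numFieldNormedType.Exports.

Local Open Scope classical_set_scope.
Local Open Scope ring_scope.

(** * Derivatives and constancy on open sets and intervals *)

Section DerivativeOnOpenSet.
Variable R : realType.

Lemma is_derive_derive1 (V : normedModType R) (f : R -> V) t :
  derivable f t 1 -> is_derive t 1 f (derive1 f t).
Proof. by move=> df; rewrite derive1E; exact: derivableP. Qed.

(** A derivative depends only on the values near [t], and openness of [I] makes [f] agree there with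
    a constant function. *)
Lemma is_derive_cst_on (V : normedModType R) (I : set R) (f : R -> V)
    (a df : V) t :
  open I -> I t -> (forall s, I s -> f s = a) -> is_derive t 1 f df -> df = 0.
Proof.
move=> oI It fa [_ <-]; rewrite -(derive_cst a t 1).
apply: near_eq_derive; near=> s; apply: fa; near: s.
exact: open_nbhs_nbhs.
Unshelve. all: by end_near. Qed.

(** Mean value theorem on the segment between two points, which stays inside [I] because [I] is an
    interval. *)
Lemma derive0_cst_on (I : set R) (f : R -> R) :
  is_interval I -> (forall t, I t -> is_derive t 1 f 0) ->
  forall s t, I s -> I t -> f s = f t.
Proof.
move=> itvI df.
suff le_cst s t : I s -> I t -> s <= t -> f s = f t.
  by move=> s t Is It; case: (leP s t) => [/le_cst|/ltW/le_cst] ->.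
move=> Is It st.
have Iu u : s <= u <= t -> I u by move/itvI; exact.
have [u /itvP uI||u _] := @MVT_segment R f (fun=> 0) s t st.
- by apply/df/Iu; rewrite !uI.
- apply: derivable_within_continuous => u /itvP uI.
  by have [] := df u (Iu u _); rewrite ?uI.
- by rewrite mul0r => /eqP; rewrite subr_eq0 => /eqP.
Qed.

Lemma is_derive_mul (f g : R -> R) (t df dg : R) :
  is_derive t 1 f df -> is_derive t 1 g dg ->
  is_derive t 1 (fun s => f s * g s) (f t * dg + g t * df).
Proof. by move=> Df Dg; have := is_deriveM Df Dg. Qed.

Lemma is_derive_coord (u : R -> 'rV[R]_3) (du : 'rV[R]_3) (t : R) i :
  is_derive t 1 u du -> is_derive t 1 (fun s => u s 0 i) (du 0 i).
Proof.
move=> [du1 <-]; have du2 := (derivable_mxP _ _ _).1 du1 0 i.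
by rewrite derive_mx// mxE; exact: derivableP.
Qed.

Lemma is_derive_rowP (u : R -> 'rV[R]_3) (du : 'rV[R]_3) (t : R) :
  (forall i, is_derive t 1 (fun s => u s 0 i) (du 0 i)) -> is_derive t 1 u du.
Proof.
move=> dui.
have du1 : derivable u t 1.
  by apply/derivable_mxP => j i; rewrite (ord1 j); have [] := dui i.
apply: DeriveDef => //; rewrite derive_mx//; apply/rowP => i.
by rewrite mxE; have [] := dui i.
Qed.

(** Values near [t] stay on the same side of 0 as [f t]. A sign factor is thus locally constant and
    passes through differentiation. *)
Lemma near_sg (f : R -> R) (t : R) :
  {for t, continuous f} -> f t != 0 ->
  \forall s \near t, Num.sg (f s) = Num.sg (f t).
Proof.
move=> fcont; rewrite neq_lt => /orP[ft|ft].
  have nft : \forall s \near t, f s < 0 := cvgr_lt (f t) fcont 0 ft.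
  near=> s; rewrite (ltr0_sg ft); apply: ltr0_sg; near: s; exact: nft.
have nft : \forall s \near t, 0 < f s := cvgr_gt (f t) fcont 0 ft.
near=> s; rewrite (gtr0_sg ft); apply: gtr0_sg; near: s; exact: nft.
Unshelve. all: by end_near. Qed.

(** Finite-order form of [smooth_on], for scalar and vector values alike, so that closure properties
    can be proved by induction on [n]; order 0 is vacuous. *)
Definition smooth_upto n (V : normedModType R) (I : set R) (f : R -> V) :=
  forall k t, (k < n)%N -> I t -> derivable (derive1n k f) t 1.

(** * Closure properties of smoothness on an open set *)

Section Smooth.
Variable I : set R.
Hypothesis oI : open I.

Lemma smooth_uptoS n (V : normedModType R) (f : R -> V) :
  smooth_upto n.+1 I f <->
  (forall t, I t -> derivable f t 1) /\ smooth_upto n I (derive1 f).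
Proof.
split=> [sf|[df sf] [|k] t kn It].
- by split=> [t /(sf 0%N)|k t kn It]; [exact|rewrite -derive1Sn; exact: sf].
- exact: df.
- by rewrite derive1Sn; exact: sf.
Qed.

Lemma smooth_uptoW n (V : normedModType R) (f : R -> V) :
  smooth_upto n.+1 I f -> smooth_upto n I f.
Proof. by move=> sf k t kn; exact/sf/leqW. Qed.

Lemma near_open (V : normedModType R) (f g : R -> V) t :
  (forall s, I s -> f s = g s) -> I t -> \forall s \near t, f s = g s.
Proof.
by move=> fg It; near=> s; apply: fg; near: s; exact: open_nbhs_nbhs.
Unshelve. all: by end_near. Qed.

(** Equality on the open set [I] is equality near each of its points, so it passes to the
    derivatives and the induction proceeds. *)
Lemma eq_smooth_upto n (V : normedModType R) (f g : R -> V) :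
  (forall t, I t -> f t = g t) -> smooth_upto n I f -> smooth_upto n I g.
Proof.
elim: n f g => [|n IHn] f g fg; first by move=> _ [].
move=> /smooth_uptoS[df sf]; apply/smooth_uptoS; split=> [t It|].
  exact: near_eq_derivable (near_open fg It) (df t It).
apply: IHn sf => t It; rewrite !derive1E.
exact: near_eq_derive (near_open fg It).
Qed.

(** The induction step of the closure lemmas: an explicit derivative, valid on [I] only, stands in
    for [derive1 f]. *)
Lemma smooth_upto_is_derive n (V : normedModType R) (f f' : R -> V) :
  (forall t, I t -> is_derive t 1 f (f' t)) -> smooth_upto n I f' ->
  smooth_upto n.+1 I f.
Proof.
move=> df sf'; apply/smooth_uptoS; split=> [t /df[]//|].
by apply: eq_smooth_upto sf' => t /df[_ <-]; rewrite derive1E.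
Qed.

Lemma smooth_uptoD n (V : normedModType R) (f g : R -> V) :
  smooth_upto n I f -> smooth_upto n I g ->
  smooth_upto n I (fun t => f t + g t).
Proof.
elim: n f g => [|n IHn] f g; first by move=> _ _ [].
move=> /smooth_uptoS[df sf] /smooth_uptoS[dg sg].
apply: smooth_upto_is_derive (IHn _ _ sf sg) => t It.
by apply: is_deriveD; apply: is_derive_derive1; [exact: df|exact: dg].
Qed.

Lemma smooth_uptoN n (V : normedModType R) (f : R -> V) :
  smooth_upto n I f -> smooth_upto n I (fun t => - f t).
Proof.
elim: n f => [|n IHn] f; first by move=> _ [].
move=> /smooth_uptoS[df sf].
apply: smooth_upto_is_derive (IHn _ sf) => t It.
by apply: is_deriveN; apply: is_derive_derive1; exact: df.
Qed.

Lemma smooth_uptoM n (f g : R -> R) :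
  smooth_upto n I f -> smooth_upto n I g ->
  smooth_upto n I (fun t => f t * g t).
Proof.
elim: n f g => [|n IHn] f g; first by move=> _ _ [].
move=> sf sg; have /smooth_uptoS[df sf'] := sf.
have /smooth_uptoS[dg sg'] := sg.
apply: (@smooth_upto_is_derive _ _ _
    (fun t => f t * derive1 g t + g t * derive1 f t)).
  by move=> t It; apply: is_derive_mul; apply: is_derive_derive1;
    [exact: df|exact: dg].
exact: smooth_uptoD (IHn _ _ (smooth_uptoW sf) sg')
                    (IHn _ _ (smooth_uptoW sg) sf').
Qed.

(** The derivative of [1/f] is a polynomial in [1/f] and [f'], both smooth to the lower order by
    induction. *)
Lemma smooth_uptoV n (f : R -> R) :
  (forall t, I t -> f t != 0) ->
  smooth_upto n I f -> smooth_upto n I (fun t => (f t)^-1).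
Proof.
move=> f0; elim: n => [|n IHn]; first by move=> _ [].
move=> sf; have /smooth_uptoS[df sf'] := sf.
have sV := IHn (smooth_uptoW sf).
apply: (@smooth_upto_is_derive _ _ _
    (fun t => - ((f t)^-1 * (f t)^-1) * derive1 f t)).
  move=> t It; apply: is_derive_eq.
    by apply: is_deriveV; [exact: f0|apply: is_derive_derive1; exact: df].
  by rewrite /GRing.scale/= -exprVn expr2.
exact: smooth_uptoM (smooth_uptoN (smooth_uptoM sV sV)) sf'.
Qed.

Lemma smooth_upto_sqrt n (f : R -> R) :
  (forall t, I t -> 0 < f t) ->
  smooth_upto n I f -> smooth_upto n I (fun t => Num.sqrt (f t)).
Proof.
move=> f0; elim: n => [|n IHn]; first by move=> _ [].
move=> sf; have /smooth_uptoS[df sf'] := sf.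
have sS := IHn (smooth_uptoW sf).
(* The usual factor [2 sqrt f] is written as a sum, so that closure under addition and inverse
   covers it. *)
apply: (@smooth_upto_is_derive _ _ _
    (fun t => (Num.sqrt (f t) + Num.sqrt (f t))^-1 * derive1 f t)).
  move=> t It; apply: is_derive_eq.
    apply: (@is_derive1_comp R Num.sqrt f); last exact/is_derive_derive1/df.
    exact/is_derive1_sqrt/f0.
  by rewrite mulrDl mul1r.
apply: smooth_uptoM sf'; apply: smooth_uptoV (smooth_uptoD sS sS) => t It.
by rewrite lt0r_neq0// addr_gt0// sqrtr_gt0 f0.
Qed.

(** Reduces smoothness of vectors to scalars; for the converse the derivative is assembled from
    those of the coordinates. *)
Lemma smooth_upto_row n (u : R -> 'rV[R]_3) :
  smooth_upto n I u <-> forall i, smooth_upto n I (fun t => u t 0 i).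
Proof.
split.
  move=> su i; elim: n u su => [|n IHn] u; first by move=> _ [].
  move=> /smooth_uptoS[du su].
  apply: smooth_upto_is_derive (IHn _ su) => t It.
  exact/is_derive_coord/is_derive_derive1/du.
elim: n u => [|n IHn] u; first by move=> _ [].
move=> sui; pose u' t := \row_i derive1 (fun s => u s 0 i) t : 'rV[R]_3.
have du t : I t -> is_derive t 1 u (u' t).
  move=> It; apply: is_derive_rowP => i; rewrite mxE; apply: is_derive_derive1.
  by have /smooth_uptoS[dui _] := sui i; exact: dui.
apply: (smooth_upto_is_derive du); apply: IHn => i.
have /smooth_uptoS[_] := sui i.
by apply: eq_smooth_upto => t It; rewrite mxE.
Qed.

End Smooth.
End DerivativeOnOpenSet.

(** * Euclidean algebra of the dot and cross products *)

Section VectorAlgebra.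
Variable R : realType.
Implicit Types (a b u v w : 'rV[R]_3) (k l : R).

(** The last index is written [1 + 1], as in the coordinate formulas for [cross], so that [ring]
    sees the same atoms. *)
Lemma dotE u v :
  dot u v = u 0 0 * v 0 0 + u 0 1 * v 0 1 + u 0 (1 + 1) * v 0 (1 + 1).
Proof.
rewrite /dot !big_ord_recl big_ord0 addr0 addrA.
by congr (_ + _ * _ + _ * _); congr (fun_of_matrix _ _ _); apply: val_inj.
Qed.

Lemma cross0 u v :
  cross u v 0 0 = u 0 1 * v 0 (1 + 1) - u 0 (1 + 1) * v 0 1.
Proof. by rewrite mxE add0r. Qed.

Lemma cross1 u v :
  cross u v 0 1 = u 0 (1 + 1) * v 0 0 - u 0 0 * v 0 (1 + 1).
Proof.
rewrite mxE.
by congr (_ * _ - _ * _); congr (fun_of_matrix _ _ _); apply: val_inj.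
Qed.

Lemma cross2 u v :
  cross u v 0 (1 + 1) = u 0 0 * v 0 1 - u 0 1 * v 0 0.
Proof.
rewrite mxE.
by congr (_ * _ - _ * _); congr (fun_of_matrix _ _ _); apply: val_inj.
Qed.

Definition crossE := (cross0, cross1, cross2).

Lemma dotC u v : dot u v = dot v u.
Proof. by rewrite !dotE; ring. Qed.

Lemma dotDl u v w : dot (u + v) w = dot u w + dot v w.
Proof. by rewrite !dotE !mxE; ring. Qed.

Lemma dotZl k u v : dot (k *: u) v = k * dot u v.
Proof. by rewrite !dotE !mxE; ring. Qed.

Lemma dot_linl k l u v w : dot (k *: u + l *: v) w = k * dot u w + l * dot v w.
Proof. by rewrite dotDl !dotZl. Qed.

Lemma dotNl u v : dot (- u) v = - dot u v.
Proof. by rewrite !dotE !mxE; ring. Qed.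

Lemma dotDr u v w : dot w (u + v) = dot w u + dot w v.
Proof. by rewrite !dotE !mxE; ring. Qed.

Lemma dotZr k u v : dot v (k *: u) = k * dot v u.
Proof. by rewrite !dotE !mxE; ring. Qed.

Lemma dot0r u : dot u 0 = 0.
Proof. by rewrite !dotE !mxE; ring. Qed.

Lemma dot_crossl u v : dot (cross u v) u = 0.
Proof. by rewrite !dotE !crossE; ring. Qed.

Lemma dot_crossr u v : dot (cross u v) v = 0.
Proof. by rewrite !dotE !crossE; ring. Qed.

(** The Binet-Cauchy identity. *)
Lemma dot_cross_cross u v a b :
  dot (cross u v) (cross a b) = dot u a * dot v b - dot u b * dot v a.
Proof. by rewrite !dotE !crossE; ring. Qed.

Lemma dot_ge0 u : 0 <= dot u u.
Proof. by rewrite /dot sumr_ge0// => i _; rewrite -expr2 sqr_ge0. Qed.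

Lemma dot_eq0 u : (dot u u == 0) = (u == 0).
Proof.
apply/idP/eqP => [|->]; last by rewrite dot0r.
rewrite /dot psumr_eq0 => [/allP u0|i _]; last by rewrite -expr2 sqr_ge0.
apply/rowP => i; have := u0 i (mem_index_enum i).
by rewrite mulf_eq0 orbb mxE => /eqP.
Qed.

Lemma dot_gt0 u : (0 < dot u u) = (u != 0).
Proof. by rewrite lt0r dot_ge0 andbT dot_eq0. Qed.

Lemma enorm_gt0 u : (0 < enorm u) = (u != 0).
Proof. by rewrite sqrtr_gt0 dot_gt0. Qed.

Lemma enorm_neq0 u : (enorm u != 0) = (u != 0).
Proof. by rewrite -enorm_gt0 lt0r sqrtr_ge0 andbT. Qed.

Lemma sqr_enorm u : enorm u ^+ 2 = dot u u.
Proof. by rewrite sqr_sqrtr// dot_ge0. Qed.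

Lemma enorm_eq1 u : dot u u = 1 -> enorm u = 1.
Proof. by rewrite /enorm => ->; rewrite sqrtr1. Qed.

Lemma enormZ k u : enorm (k *: u) = `|k| * enorm u.
Proof.
by rewrite /enorm dotZl dotZr mulrA -expr2 sqrtrM ?sqr_ge0// sqrtr_sqr.
Qed.

Lemma dot_unit u : u != 0 -> dot ((enorm u)^-1 *: u) ((enorm u)^-1 *: u) = 1.
Proof.
move=> u0; rewrite dotZl dotZr mulrA -invfM -expr2 sqr_enorm mulVf//.
by rewrite dot_eq0.
Qed.

(** By Lagrange's identity, [|u|^2 |v|^2 - <u,v>^2] is the square [|u x v|^2]. *)
Lemma cauchy_schwarz u v : `|dot u v| <= enorm u * enorm v.
Proof.
rewrite -(@ler_pXn2r _ 2) ?nnegrE ?mulr_ge0 ?sqrtr_ge0//.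
rewrite real_normK ?num_real// exprMn !sqr_enorm -subr_ge0.
have := dot_ge0 (cross u v).
by rewrite dot_cross_cross (dotC v u) -expr2.
Qed.

Lemma line_angle_unit u v : dot u u = 1 ->
  line_angle u v = acos (`|dot u v| / enorm v).
Proof. by move=> /enorm_eq1 u1; rewrite /line_angle u1 mul1r. Qed.

(* [a x (u x v) = <a,v> u - <a,u> v] vanishes, so by Lagrange's identity
   [|a|^2 |u x v|^2 = <a, u x v>^2 = 0]. *)
Lemma orthonormal_eq0 u v a : dot u u = 1 -> dot v v = 1 -> dot u v = 0 ->
  dot a u = 0 -> dot a v = 0 -> dot a (cross u v) = 0 -> a = 0.
Proof.
move=> uu vv uv au av ab; apply/eqP; rewrite -dot_eq0.
have bac : dot (cross a (cross u v)) (cross a (cross u v))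
    = dot a v ^+ 2 * dot u u + dot a u ^+ 2 * dot v v
      - 2 * dot a v * dot a u * dot u v.
  by rewrite !dotE !crossE; ring.
move: bac; rewrite dot_cross_cross (dotC _ a) ab dot_cross_cross uu vv.
rewrite (dotC v u) uv au av => /eqP.
by rewrite !(expr0n, mulr0, mul0r, subr0, addr0, mulr1).
Qed.

End VectorAlgebra.

(** * Derivatives and smoothness of vector-valued functions *)

Section VectorDerivatives.
Variable R : realType.
Implicit Types (I : set R) (u v : R -> 'rV[R]_3).

Lemma is_derive_dot u v (du dv : 'rV[R]_3) (t : R) :
  is_derive t 1 u du -> is_derive t 1 v dv ->
  is_derive t 1 (fun s => dot (u s) (v s)) (dot du (v t) + dot (u t) dv).
Proof.
move=> Du Dv; pose p i s : R := u s 0 i * v s 0 i.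
have dp i : is_derive t 1 (p i) (u t 0 i * dv 0 i + v t 0 i * du 0 i).
  by apply: is_derive_mul; exact: is_derive_coord.
have := is_deriveD (is_deriveD (dp 0) (dp 1)) (dp (1 + 1)).
have -> : (p 0 + p 1 + p (1 + 1)) = (fun s => dot (u s) (v s)).
  by apply/funext => s; rewrite dotE.
by move/is_derive_eq; apply; rewrite !dotE; ring.
Qed.

Section SmoothVectors.
Variable I : set R.
Hypothesis oI : open I.

Lemma smooth_onP (c : R -> 'rV[R]_3) :
  smooth_on I c <-> forall n, smooth_upto n I c.
Proof. by split=> [sc n k t _|sc n t]; [exact: sc|exact: (sc n.+1)]. Qed.

Lemma smooth_on_derive1 u : smooth_on I u -> smooth_on I (derive1 u).
Proof. by move=> su n t It; rewrite -derive1Sn; exact: su. Qed.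

Lemma smooth_upto_dot n u v : smooth_upto n I u -> smooth_upto n I v ->
  smooth_upto n I (fun t => dot (u t) (v t)).
Proof.
move=> /(smooth_upto_row oI) su /(smooth_upto_row oI) sv.
pose p i s : R := u s 0 i * v s 0 i.
have sp i : smooth_upto n I (p i) by exact: smooth_uptoM.
apply: (eq_smooth_upto oI)
  (smooth_uptoD oI (smooth_uptoD oI (sp 0) (sp 1)) (sp (1 + 1))).
by move=> t It; rewrite dotE.
Qed.

Lemma smooth_on_cross u v : smooth_on I u -> smooth_on I v ->
  smooth_on I (fun t => cross (u t) (v t)).
Proof.
move=> /smooth_onP su /smooth_onP sv; apply/smooth_onP => n.
have {}su := (smooth_upto_row oI _ _).1 (su n).
have {}sv := (smooth_upto_row oI _ _).1 (sv n).
apply/(smooth_upto_row oI) => i.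
have sp j k : smooth_upto n I (fun t => u t 0 j * v t 0 k).
  exact: smooth_uptoM.
apply: (eq_smooth_upto oI) (smooth_uptoD oI (sp (i + 1) (i + 1 + 1))
   (smooth_uptoN oI (sp (i + 1 + 1) (i + 1)))).
by move=> t It; rewrite mxE.
Qed.

(** The norm is the square root of a positive smooth function. This serves for both [T] and [N], the
    normalizations of [c'] and [T']. *)
Lemma smooth_on_unit u : (forall t, I t -> u t != 0) -> smooth_on I u ->
  smooth_on I (fun t => (enorm (u t))^-1 *: u t).
Proof.
move=> u0 /smooth_onP su; apply/smooth_onP => n.
have snorm : smooth_upto n I (fun t => (enorm (u t))^-1).
  apply: smooth_uptoV => // [t It|]; first by rewrite enorm_neq0 u0.
  apply: smooth_upto_sqrt => // [t It|]; first by rewrite dot_gt0 u0.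
  exact: smooth_upto_dot.
have {}su := (smooth_upto_row oI _ _).1 (su n).
apply/(smooth_upto_row oI) => i.
apply: (eq_smooth_upto oI) (smooth_uptoM oI snorm (su i)) => t It.
by rewrite mxE.
Qed.

End SmoothVectors.
End VectorDerivatives.

(** * Frenet frame and Frenet equations for an arbitrary parameter *)

Section Frenet.
Variables (R : realType) (I : set R) (c : R -> 'rV[R]_3).
Hypothesis rc : regular_curve I c.

Local Notation v t := (enorm (derive1 c t)).
Local Notation T := (tangent_vec c).
Local Notation N := (normal_vec c).
Local Notation B := (binormal_vec c).
Local Notation kappa := (curvature c).
Local Notation tau := (torsion c).

Let oI : open I.
Proof. by case: rc => -[]. Qed.

Lemma speed_neq0 t : I t -> v t != 0.
Proof. by case: rc => _ _ c0 _ It; rewrite enorm_neq0 c0. Qed.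

Lemma curvature_neq0 t : I t -> kappa t != 0.
Proof. by case: rc => _ _ _; exact. Qed.

Lemma derive1_tangent_neq0 t : I t -> derive1 T t != 0.
Proof.
move=> /curvature_neq0; apply: contra_neq => T0.
by rewrite /curvature T0 /enorm dot0r sqrtr0 mul0r.
Qed.

Lemma smooth_tangent : smooth_on I T.
Proof.
have [_ sc c0 _] := rc.
exact: smooth_on_unit oI _ c0 (smooth_on_derive1 sc).
Qed.

Lemma smooth_normal : smooth_on I N.
Proof.
exact: smooth_on_unit oI _ derive1_tangent_neq0
                      (smooth_on_derive1 smooth_tangent).
Qed.

Lemma smooth_binormal : smooth_on I B.
Proof. exact: smooth_on_cross oI _ _ smooth_tangent smooth_normal. Qed.

Lemma is_derive_smooth_on (u : R -> 'rV[R]_3) t :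
  smooth_on I u -> I t -> is_derive t 1 u (derive1 u t).
Proof. by move=> su It; apply: is_derive_derive1; exact: (su 0%N). Qed.

Lemma dotTT t : I t -> dot (T t) (T t) = 1.
Proof. by case: rc => _ _ c0 _ It; rewrite dot_unit// c0. Qed.

Lemma dotNN t : I t -> dot (N t) (N t) = 1.
Proof. by move=> It; rewrite dot_unit// derive1_tangent_neq0. Qed.

Lemma derive1_tangent t : I t -> derive1 T t = (kappa t * v t) *: N t.
Proof.
move=> It; rewrite /curvature divfK ?speed_neq0// /normal_vec scalerA.
by rewrite divff ?scale1r// enorm_neq0 derive1_tangent_neq0.
Qed.

(** Differentiating the constant [<u,w>]; this gives the skew-symmetry of the Frenet equations. *)
Lemma dot_derive1 (u w : R -> 'rV[R]_3) a t : smooth_on I u -> smooth_on I w ->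
  (forall s, I s -> dot (u s) (w s) = a) -> I t ->
  dot (derive1 u t) (w t) = - dot (derive1 w t) (u t).
Proof.
move=> su sw uwa It; apply/eqP; rewrite -addr_eq0 (dotC (derive1 w t)).
apply/eqP.
exact: is_derive_cst_on oI It uwa
  (is_derive_dot (is_derive_smooth_on su It) (is_derive_smooth_on sw It)).
Qed.

Lemma dot_derive1_self (u : R -> 'rV[R]_3) a t : smooth_on I u ->
  (forall s, I s -> dot (u s) (u s) = a) -> I t -> dot (derive1 u t) (u t) = 0.
Proof.
move=> su ua It; have /eqP := dot_derive1 su su ua It.
by rewrite -addr_eq0 -mulr2n mulrn_eq0 => /eqP.
Qed.

Lemma dotTN t : I t -> dot (T t) (N t) = 0.
Proof.
move=> It; rewrite dotZr dotC (dot_derive1_self smooth_tangent dotTT It).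
by rewrite mulr0.
Qed.

Lemma dotBT t : dot (B t) (T t) = 0.
Proof. exact: dot_crossl. Qed.

Lemma dotBN t : dot (B t) (N t) = 0.
Proof. exact: dot_crossr. Qed.

Lemma dotBB t : I t -> dot (B t) (B t) = 1.
Proof.
move=> It; rewrite dot_cross_cross dotTT// dotNN// dotTN// mul0r subr0.
exact: mulr1.
Qed.

(** The difference [a - b] is orthogonal to an orthonormal frame, hence zero. *)
Lemma frenet_ext t (a b : 'rV[R]_3) : I t -> dot a (T t) = dot b (T t) ->
  dot a (N t) = dot b (N t) -> dot a (B t) = dot b (B t) -> a = b.
Proof.
move=> It aT aN aB; apply/eqP; rewrite -subr_eq0; apply/eqP.
apply: orthonormal_eq0 (dotTT It) (dotNN It) (dotTN It) _ _ _;
  by rewrite dotDl dotNl ?aT ?aN ?aB subrr.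
Qed.

Lemma dot_derive1_binormal_normal t :
  I t -> dot (derive1 B t) (N t) = - (tau t * v t).
Proof. by move=> It; rewrite /torsion divfK ?speed_neq0// opprK. Qed.

(** The [T] component vanishes because [T'] is parallel to [N], the [B] component because [B] has
    unit length; the [N] component defines the torsion. *)
Lemma derive1_binormal t : I t -> derive1 B t = - (tau t * v t) *: N t.
Proof.
move=> It; apply: (frenet_ext It); rewrite dotZl.
- rewrite (dot_derive1 smooth_binormal smooth_tangent (fun s _ => dotBT s) It).
  rewrite derive1_tangent// dotZl (dotC _ (B t)) dotBN (dotC _ (T t)) dotTN//.
  by rewrite !mulr0 oppr0.
- by rewrite dot_derive1_binormal_normal// dotNN// mulr1.
- rewrite (dot_derive1_self smooth_binormal dotBB It).
  by rewrite (dotC _ (B t)) dotBN mulr0.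
Qed.

(** By skew-symmetry the components of [N'] along [T] and [B] are read off from [T'] and [B']. *)
Lemma derive1_normal t : I t ->
  derive1 N t = - (kappa t * v t) *: T t + (tau t * v t) *: B t.
Proof.
move=> It; apply: (frenet_ext It); rewrite dot_linl.
- rewrite dotBT dotTT// mulr1 mulr0 addr0.
  have dotNT s : I s -> dot (N s) (T s) = 0 by move=> Is; rewrite dotC dotTN.
  rewrite (dot_derive1 smooth_normal smooth_tangent dotNT It).
  by rewrite derive1_tangent// dotZl dotNN// mulr1.
- rewrite (dot_derive1_self smooth_normal dotNN It) dotBN dotTN//.
  by rewrite !mulr0 addr0.
- have dotNB s : I s -> dot (N s) (B s) = 0 by move=> Is; rewrite dotC dotBN.
  rewrite (dot_derive1 smooth_normal smooth_binormal dotNB It).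
  rewrite dot_derive1_binormal_normal// (dotC (T t)) dotBT dotBB//.
  by rewrite opprK mulr0 add0r mulr1.
Qed.

(** Its component along [T] is [- kappa v], which does not vanish. *)
Lemma derive1_normal_neq0 t : I t -> derive1 N t != 0.
Proof.
move=> It; have : dot (derive1 N t) (T t) != 0.
  rewrite derive1_normal// dot_linl dotBT dotTT// mulr0 mulr1 addr0 oppr_eq0.
  by rewrite mulf_neq0 ?curvature_neq0 ?speed_neq0.
by apply: contra_neq => ->; rewrite dotC dot0r.
Qed.

(** * Helices and slant helices in terms of a fixed direction *)

Lemma is_derive_dot_cst (u : R -> 'rV[R]_3) d t : smooth_on I u -> I t ->
  is_derive t 1 (fun s => dot (u s) d) (dot (derive1 u t) d).
Proof.
move=> su It;
have := is_derive_dot (is_derive_smooth_on su It) (is_derive_cst d t 1).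
by move/is_derive_eq; apply; rewrite dot0r addr0.
Qed.

Lemma dot_cst (u : R -> 'rV[R]_3) d : smooth_on I u ->
  (forall t, I t -> dot (derive1 u t) d = 0) ->
  forall s t, I s -> I t -> dot (u s) d = dot (u t) d.
Proof.
move=> su du0; case: rc => -[_ _ itvI] _ _ _.
apply: (@derive0_cst_on R I (fun s => dot (u s) d)) => // t It.
by rewrite -(du0 t It); exact: is_derive_dot_cst.
Qed.

(* Lancret: the axis of a helix is [(tau / kappa) T + B]. *)
Lemma helix_orthogonal_normal :
  helix I c <-> exists2 d, d != 0 & forall t, I t -> dot (N t) d = 0.
Proof.
have [[[t0 It0] _ itvI] _ _ _] := rc.
split=> [[k tauk]|[d d0 Nd]].
  have tauE t : I t -> tau t = k * kappa t.
    by move=> It; rewrite -(tauk t It) divfK ?curvature_neq0.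
  pose d t := k *: T t + B t.
  (* The derivative of [k T + B] is [(k kappa - tau) v N = 0]; constancy is then obtained coordinate
     by coordinate. *)
  have dE t : I t -> d t = d t0.
    move=> It; apply/rowP => i.
    apply: (@derive0_cst_on R I (fun s => d s 0 i)) => // s Is.
    suff : is_derive s 1 d (0 : 'rV[R]_3).
      by move/(is_derive_coord i); rewrite mxE.
    have := is_deriveD (is_deriveZ k (is_derive_smooth_on smooth_tangent Is))
                       (is_derive_smooth_on smooth_binormal Is).
    move/is_derive_eq; apply.
    rewrite derive1_tangent// derive1_binormal// tauE// scalerA mulrA -scalerDl.
    by rewrite subrr scale0r.
  exists (d t0) => [|t It].
    have : dot (d t0) (B t0) = 1.
      by rewrite dotDl dotZl (dotC (T t0)) dotBT dotBB// mulr0 add0r.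
    by apply: contra_eq_neq => ->; rewrite dotC dot0r eq_sym oner_neq0.
  rewrite -(dE t It) dotDr dotZr (dotC _ (T t)) dotTN// (dotC _ (B t)) dotBN.
  by rewrite mulr0 addr0.
(* Both [T'] and [B'] are parallel to [N], so [T] and [B] have constant components along [d]. *)
have Tcst : forall s t, I s -> I t -> dot (T s) d = dot (T t) d.
  apply: (dot_cst smooth_tangent) => t It.
  by rewrite derive1_tangent// dotZl Nd// mulr0.
have Bcst : forall s t, I s -> I t -> dot (B s) d = dot (B t) d.
  apply: (dot_cst smooth_binormal) => t It.
  by rewrite derive1_binormal// dotZl Nd// mulr0.
(* Differentiate [<N,d> = 0] and cancel the speed. *)
have tauB t : I t -> tau t * dot (B t) d = kappa t * dot (T t) d.
  move=> It.
  have := is_derive_cst_on oI It Nd (is_derive_dot_cst d smooth_normal It).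
  rewrite derive1_normal// dot_linl => /eqP; rewrite mulNr addrC subr_eq0.
  rewrite mulrAC [eqbRHS]mulrAC => /eqP; exact/mulIf/speed_neq0.
(* Otherwise [<T,d>] vanishes too, and [d] is orthogonal to the whole frame. *)
have Bd t : I t -> dot (B t) d != 0.
  move=> It; apply: contra_neq d0 => Bd0.
  have := tauB t It; rewrite Bd0 mulr0 => /esym/eqP.
  rewrite mulf_eq0 (negPf (curvature_neq0 It)) => /eqP Td0.
  by apply: (frenet_ext It); rewrite dotC ?Td0 ?Nd// ?Bd0 dotC dot0r.
exists (dot (T t0) d / dot (B t0) d) => t It.
rewrite (Tcst t0 t)// (Bcst t0 t)//; apply/eqP.
by rewrite eqr_div ?curvature_neq0 ?Bd// tauB// mulrC.
Qed.

(** A constant line angle means that [|<N,d>|] is constant. Squaring removes the absolute value, and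
    differentiation gives [<N,d> <N',d> = 0]. *)
Lemma slant_helix_orthogonal :
  slant_helix I c <->
  exists2 d, d != 0 & forall t, I t -> dot (derive1 N t) d = 0.
Proof.
have [[[t0 It0] _ itvI] _ _ _] := rc.
split=> [[d [theta [d0 angle]]]|[d d0 dN]]; last first.
  have [a Nd] : exists a, forall t, I t -> dot (N t) d = a.
    exists (dot (N t0) d) => t It.
    exact: dot_cst smooth_normal dN _ _ It It0.
  exists d, (acos (`|a| / enorm d)); split=> [|t It]; first exact: d0.
  by rewrite (line_angle_unit d (dotNN It)) Nd.
exists d => [|t It]; first exact: d0.
have d_gt0 : 0 < enorm d by rewrite enorm_gt0.
(* Inverting [acos] requires its argument to lie in [[-1, 1]], which is Cauchy-Schwarz. *)
have normE s : I s -> `|dot (N s) d| = cos theta * enorm d.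
  move=> Is; rewrite -(angle s Is) (line_angle_unit d (dotNN Is)) acosK.
    by rewrite divfK// gt_eqF.
  rewrite in_itv/=; apply/andP; split.
    by apply: le_trans (lerN10 _) _; rewrite divr_ge0// ltW.
  rewrite ler_pdivrMr// mul1r (le_trans (cauchy_schwarz _ _))//.
  by rewrite (enorm_eq1 (dotNN Is)) mul1r.
have sqrE s : I s -> dot (N s) d * dot (N s) d = (cos theta * enorm d) ^+ 2.
  by move=> Is; rewrite -(normE s Is) real_normK ?num_real// expr2.
have dNd := is_derive_dot_cst d smooth_normal It.
have := is_derive_cst_on oI It sqrE (is_derive_mul dNd dNd).
move/eqP; rewrite -mulr2n mulrn_eq0 mulf_eq0/= => /orP[|/eqP//].
(* If [<N,d>] vanishes at [t], its constant absolute value is 0, so it vanishes on all of [I] and so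
   does its derivative. *)
rewrite -normr_eq0 normE// => /eqP cst0.
apply: (is_derive_cst_on (a := 0) oI It _ dNd) => s Is.
by apply/eqP; rewrite -normr_eq0 normE// cst0.
Qed.

(** * The binormal indicatrix of a non-planar curve *)

Hypothesis tau0 : non_planar I c.

Lemma derive1_binormal_neq0 t : I t -> derive1 B t != 0.
Proof.
move=> It; have N0 : N t != 0 by rewrite -dot_eq0 dotNN// oner_eq0.
by rewrite derive1_binormal// scaler_eq0 oppr_eq0 mulf_eq0 negb_or negb_or
  tau0// speed_neq0.
Qed.

(* The torsion keeps its sign near [t], hence [T_B = - sg(tau) N] there. *)
Lemma derive1_tangent_binormal (t : R) : I t ->
  exists2 e : R, e != 0 & derive1 (tangent_vec B) t = e *: derive1 N t.
Proof.
(* [f] is [- tau v], of sign opposite to the torsion; as a dot product of smooth curves it is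
   continuous. *)
move=> It; pose f (s : R) : R := dot (derive1 B s) (N s).
have f0 s : I s -> f s != 0.
  move=> Is; rewrite /f dot_derive1_binormal_normal// oppr_eq0.
  by rewrite mulf_neq0 ?tau0 ?speed_neq0.
have df := is_derive_dot
  (is_derive_smooth_on (smooth_on_derive1 smooth_binormal) It)
  (is_derive_smooth_on smooth_normal It).
have fcont : {for t, continuous f}.
  by case: df => df _; exact/differentiable_continuous/derivable1_diffP.
(* Here [B' = f N] with [N] a unit vector, so normalizing leaves [f / |f|]. *)
have TB s : I s -> tangent_vec B s = Num.sg (f s) *: N s.
  move=> Is; rewrite /tangent_vec derive1_binormal// enormZ.
  rewrite (enorm_eq1 (dotNN Is)) mulr1 -dot_derive1_binormal_normal//.
  rewrite -/(f s) scalerA; congr (_ *: _).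
  by rewrite {2}[f s]numEsg mulrC mulfK// normr_eq0 f0.
have sgf := near_sg fcont (f0 t It).
exists (Num.sg (f t)); first by rewrite sgr_eq0 f0.
have nearTB : \forall s \near t, Num.sg (f t) *: N s = tangent_vec B s.
  near=> s; have -> : tangent_vec B s = Num.sg (f s) *: N s.
    by apply: TB; near: s; exact: open_nbhs_nbhs (conj oI It).
  apply: (congr1 (fun e : R => e *: N s)).
  by apply/esym; near: s; exact: sgf.
have [_ <-] := near_eq_is_derive nearTB
  (is_deriveZ (Num.sg (f t)) (is_derive_smooth_on smooth_normal It)).
by rewrite derive1E.
Unshelve. all: by end_near. Qed.

(** The curvature of [B] is nonzero because the derivative of its unit tangent is a nonzero multiple
    of [N']. *)
Lemma regular_binormal : regular_curve I B.
Proof.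
have [oI_ _ _ _] := rc.
split; [exact: oI_|exact: smooth_binormal|exact: derive1_binormal_neq0|].
move=> t It.
have [e e0 TBE] := derive1_tangent_binormal It.
rewrite /curvature TBE; apply: mulf_neq0; last first.
  by rewrite invr_eq0 enorm_neq0 derive1_binormal_neq0.
by rewrite enorm_neq0 scaler_eq0 negb_or e0 derive1_normal_neq0.
Qed.

(** The principal normal of [B] is a nonzero multiple of [N']. This turns the helix condition on [B]
    into the slant helix condition on [c]. *)
Lemma dot_normal_binormal_eq0 t d : I t ->
  dot (normal_vec B t) d = 0 <-> dot (derive1 N t) d = 0.
Proof.
move=> It; have [e e0 TBE] := derive1_tangent_binormal It.
rewrite /normal_vec -/(tangent_vec B) TBE 2!dotZl.
split=> [/eqP|->]; last by rewrite !mulr0.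
rewrite !mulf_eq0 invr_eq0 (negPf e0) (negPf (_ : enorm _ != 0)) => [/eqP//|].
by rewrite enorm_neq0 scaler_eq0 negb_or e0 derive1_normal_neq0.
Qed.

End Frenet.

Theorem corollary13 (R : realType) (I J : set R)
    (gamma gamma_mate : R -> 'rV[R]_3)
    (gamma_curve : regular_curve I gamma)
    (gamma_arclength : unit_speed I gamma)
    (mate_curve : regular_curve J gamma_mate)
    (mate_arclength : unit_speed J gamma_mate)
    (bertrand : bertrand_mate I gamma J gamma_mate)
    (gamma_non_helical : ~ helix I gamma)
    (gamma_non_planar : non_planar I gamma)
    (mate_non_helical : ~ helix J gamma_mate)
    (mate_non_planar : non_planar J gamma_mate) :
  slant_helix I gamma <-> spherical_helix I (binormal_vec gamma).
Proof.
apply: iff_trans (slant_helix_orthogonal gamma_curve) _.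
have regB := regular_binormal gamma_curve gamma_non_planar.
have normalB t d :=
  dot_normal_binormal_eq0 gamma_curve gamma_non_planar (t := t) d.
(* The same direction [d] serves both conditions; that [B] lies on the unit sphere is
   [<B,B> = 1]. *)
split=> [[d d0 Nd]|[_ _ /(helix_orthogonal_normal regB)[d d0 Nd]]].
  split=> // [t It|]; first exact/enorm_eq1/(dotBB gamma_curve).
  apply/(helix_orthogonal_normal regB); exists d => // t It.
  by apply/normalB => //; exact: Nd.
by exists d => // t It; apply/normalB => //; exact: Nd.
Qed.
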